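(* Let $G$ be a finitely generated FD-group (or FIZ-group, or FC-group) and let $H$ be a subgroup of $G$. Then the Hecke pair $(G,H)$ has (RD).
   Context: All groups are discrete. A group $G$ is an FD-group if its commutator subgroup $G'$ is finite; an FIZ-group if $G/Z(G)$ is finite, where $Z(G)$ is the center; an FC-group if all conjugacy classes of elements of $G$ are finite. A subgroup $H\leq G$ is almost normal if every double coset $HgH$ ($g\in G$) is a union of finitely many left cosets of $H$; then $(G,H)$ is called a Hecke pair. A length function on $G$ is a map $L:G\to[0,\infty)$ with $L(1)=0$, $L(g^{-1})=L(g)$ and $L(gh)\leq L(g)+L(h)$ for all $g,h\in G$; put $N_L=\{g\in G: L(g)=0\}$. A length function on a Hecke pair $(G,H)$ is a length function $L$ on $G$ with $H\subseteq N_L$ (so $L$ is constant on double cosets of $H$). $\mathcal{H}(G,H)$ is the space of finitely supported complex functions on the set of double cosets $G//H$, regarded as $H$-bi-invariant functions on $G$; elements of $\ell^2(H\backslash G)$ are regarded as left $H$-invariant functions on $G$. The regular representation $\lambda:\mathcal{H}(G,H)\to\mathcal{B}(\ell^2(H\backslash G))$ is $\lambda(f)(\xi)(g)=\sum_{h\in H\backslash G} f(gh^{-1})\xi(h)$ (sum over representatives of right cosets). For $s\geq 0$, $\|f\|_{s,L}=\big(\sum_{g\in H\backslash G}|f(g)|^2(1+L(g))^{2s}\big)^{1/2}$. The Hecke pair $(G,H)$ has property (RD) with respect to a length function $L$ on $(G,H)$ if there are $C,s>0$ with $\|\lambda(f)\|\leq C\|f\|_{s,L}$ for all $f\in\mathcal{H}(G,H)$.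 ''The Hecke pair $(G,H)$ has (RD)'' means that $H$ is almost normal in $G$ and $(G,H)$ has (RD) with respect to some length function on $(G,H)$. *)

(* Defs.v *)
From HB Require Import structures.
From mathcomp Require Import all_boot all_order all_algebra.
From mathcomp Require Import all_classical all_reals all_analysis.
From mathcomp Require Import complex.

Set Implicit Arguments.
Unset Strict Implicit.
Unset Printing Implicit Defensive.

Import Order.TTheory GRing.Theory Num.Theory ComplexField.Normc.
Local Open Scope classical_set_scope.
Local Open Scope ring_scope.

Section Groups.
Variable G : groupType.
Implicit Types (H S : set G) (g x y : G).
Local Open Scope group_scope.

Definition is_subgroup H : Prop := group_closed (mem H).

Definition generated S : set G :=
  [set x | forall K, is_subgroup K -> S `<=` K -> K x].

Definition finitely_generated : Prop :=
  exists S, finite_set S /\ generated S = setT.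

Definition derived : set G :=
  generated [set commg p.1 p.2 | p in [set: G * G]].

Definition center : set G := [set x | forall g, commute x g].

Definition lcoset H g : set G := [set g * h | h in H].
Definition rcoset H g : set G := [set h * g | h in H].
Definition dcoset H g : set G := [set p.1 * g * p.2 | p in H `*` H].

Definition rcosets H : set (set G) := [set rcoset H g | g in [set: G]].

Definition FD_group : Prop := finite_set derived.

Definition FIZ_group : Prop :=
  finite_set [set lcoset center g | g in [set: G]].

Definition FC_group : Prop :=
  forall g, finite_set [set conjg g x | x in [set: G]].

Definition almost_normal H : Prop :=
  forall g, exists2 F : set G,
    finite_set F & dcoset H g = \bigcup_(x in F) lcoset H x.

(* A chosen element of a coset; the value on the empty set is irrelevant. *)
Definition coset_rep (A : set G) : G := xget 1 A.

End Groups.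

Arguments finitely_generated : clear implicits.
Arguments FD_group : clear implicits.
Arguments FIZ_group : clear implicits.
Arguments FC_group : clear implicits.

Section Hecke.
Variables (R : realType) (G : groupType).
Implicit Types (H : set G) (L : G -> R) (f xi : G -> R[i]).

Record length_function L : Prop := LengthFunction {
  length_ge0 : forall g, 0 <= L g ;
  length1 : L 1%g = 0 ;
  lengthV : forall g, L g^-1%g = L g ;
  lengthM : forall g h, L (g * h)%g <= L g + L h }.

Definition length_kernel L : set G := [set g | L g = 0].

Definition pair_length_function H L : Prop :=
  length_function L /\ H `<=` length_kernel L.

Definition left_invariant H f : Prop :=
  forall h g, H h -> f (h * g)%g = f g.

Definition right_invariant H f : Prop :=
  forall h g, H h -> f (g * h)%g = f g.

(* Elements of H(G,H): finitely many double cosets in the support. *)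
Definition hecke_fun H f : Prop :=
  [/\ left_invariant H f, right_invariant H f &
      finite_set [set dcoset H g | g in [set g | f g != 0]]].

(* Sums over H\G run over the set of right cosets and evaluate the summand at
   a representative; every summand below is left H-invariant. Norms take
   values in \bar R, +oo standing for a divergent sum. *)

Definition l2norm H xi : \bar R :=
  ((\esum_(A in rcosets H) (normc (xi (coset_rep A)) ^+ 2)%:E)
     `^ 2^-1)%E.

Definition l2 H : set (G -> R[i]) :=
  [set xi | left_invariant H xi /\ (l2norm H xi < +oo)%E].

(* For H almost normal and f in H(G,H) this sum has finitely many nonzero
   terms, so that the finite-support sum of fsbigop is the intended one. *)
Definition regular_rep H f xi : G -> R[i] := fun g =>
  \sum_(A \in rcosets H) f (g * (coset_rep A)^-1)%g * xi (coset_rep A).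

(* The operator norm on l^2(H\G) of lambda(f), +oo if it is unbounded. *)
Definition opnorm H f : \bar R :=
  ereal_sup [set l2norm H (regular_rep H f xi) |
             xi in [set xi | l2 H xi /\ (l2norm H xi <= 1)%E]].

Definition weighted_norm H (s : R) L f : \bar R :=
  ((\esum_(A in rcosets H)
      (normc (f (coset_rep A)) ^+ 2
       * (1 + L (coset_rep A)) `^ (2 * s))%:E) `^ 2^-1)%E.

Definition has_RD_wrt H L : Prop :=
  exists C s : R, [/\ 0 < C, 0 < s &
    forall f, hecke_fun H f ->
      (opnorm H f <= C%:E * weighted_norm H s L f)%E].

Definition hecke_pair_has_RD H : Prop :=
  almost_normal H /\
  exists L, pair_length_function H L /\ has_RD_wrt H L.

End Hecke.

Arguments hecke_pair_has_RD : clear implicits.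

(* Main.v *)
(* Under each of the three hypotheses [G] is an FC-group, so it is generated by
   a finite family [T] closed under conjugation and inversion, of size [k] say.
   Let [L g] be the least [n] with [g] in [H T^n].  As [T^n] is
   conjugation-invariant, [L] is a length function vanishing on [H].  The
   relation [x y = y x^y] sorts the words in [T], so a right coset of [H] is
   determined by the numbers [a_i <= L g] of occurrences of the generators in a
   sorted word of minimal length, and for [m >= 2k]
     [\sum_(Hg) (1 + L g)^-m <= \prod_(i < k) \sum_a (1 + a)^-2 <= 2^k].
   Since [|f g| <= ||f||_(m,L) (1 + L g)^-m] pointwise and
   [(1 + L (g h^-1))^-m] is a symmetric kernel on [H\G] with row sums at most
   [2^k], Schur's test bounds the norm of [lambda(f)] by [2^k ||f||_(m,L)]. *)
Require Import Defs.
From mathcomp Require Import all_boot all_order all_algebra.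
From mathcomp Require Import all_classical all_reals all_analysis.
From mathcomp Require Import complex zify ring lra.

Set Implicit Arguments.
Unset Strict Implicit.
Unset Printing Implicit Defensive.

Import Order.TTheory GRing.Theory Num.Theory ComplexField.Normc.
Local Open Scope classical_set_scope.
Local Open Scope ring_scope.

(** * Subgroups, right cosets and their representatives *)

Section Subgroups.
Variables (G : groupType) (H : set G).
Hypothesis sgH : is_subgroup H.
Local Open Scope group_scope.

Lemma subgroup1 : H 1.
Proof. by case: sgH => H1 _; rewrite inE in H1. Qed.

Lemma subgroupV x : H x -> H x^-1.
Proof. by move=> Hx; apply/set_mem/(group_closedV sgH (mem_set Hx)). Qed.

Lemma subgroupM x y : H x -> H y -> H (x * y).
Proof.
by move=> Hx Hy; apply/set_mem/(group_closedM sgH (mem_set Hx) (mem_set Hy)).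
Qed.

Lemma rcoset_id g : rcoset H g g.
Proof. by exists 1; [exact: subgroup1 | rewrite mul1g]. Qed.

Lemma rcoset_eq h g : H h -> rcoset H (h * g) = rcoset H g.
Proof.
move=> Hh; apply/seteqP; split=> _ [k Hk <-].
  by exists (k * h); [exact: subgroupM | rewrite mulgA].
by exists (k * h^-1); [apply/subgroupM/subgroupV | rewrite mulgA mulgVK].
Qed.

Lemma coset_rep_rcoset g : exists2 h, H h & coset_rep (rcoset H g) = h * g.
Proof.
have [h Hh <-] : rcoset H g (coset_rep (rcoset H g)).
  by apply: (@xgetPex _ 1 (rcoset H g)); exists g; exact: rcoset_id.
by exists h.
Qed.

Lemma rcoset_coset_rep A : rcosets H A -> rcoset H (coset_rep A) = A.
Proof.
by case=> g _ <-; have [h Hh ->] := coset_rep_rcoset g; rewrite rcoset_eq.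
Qed.

End Subgroups.

Lemma is_subgroupP (G : groupType) (K : set G) :
  K 1%g -> (forall x, K x -> K x^-1%g) ->
  (forall x y, K x -> K y -> K (x * y)%g) -> is_subgroup K.
Proof.
move=> K1 KV KM; split; first exact/mem_set.
by move=> x y /set_mem Kx /set_mem Ky; apply/mem_set/KM => //; exact: KV.
Qed.

(** * Finite conjugacy classes *)

Section FC.
Variable G : groupType.
Local Open Scope group_scope.

(** As [g ^ x = g * [~ g, x]], the class of [g] lies in a translate of [derived]. *)
Lemma FD_group_FC : FD_group G -> FC_group G.
Proof.
move=> fin g.
apply: sub_finite_set (finite_image (fun d => g * d) fin) => _ [x _ <-].
exists [~ g, x]; last by rewrite commgEl mulVKg.
by move=> K _; apply; exists (g, x).
Qed.

(** The conjugate [g ^ x] depends only on the coset of [x] modulo the center. *)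
Lemma FIZ_group_FC : FIZ_group G -> FC_group G.
Proof.
move=> fin g.
apply: sub_finite_set (finite_image (fun A => g ^ coset_rep A) fin).
move=> _ [x _ <-]; exists (lcoset (@Defs.center G) x); first by exists x.
have [z cz <-] : lcoset (@Defs.center G) x
    (coset_rep (lcoset (@Defs.center G) x)).
  apply: (@xgetPex _ 1); exists x, 1; last by rewrite mulg1.
  by move=> y; rewrite /commute mulg1 mul1g.
by rewrite conjgM; apply/conjg_fixP/commgP/commute_sym/cz.
Qed.

(** By [h * g * k = g ^ h^-1 * (h * k)], the double coset is the union of the left cosets of the
    [H]-conjugates of [g]. *)
Lemma FC_group_almost_normal (H : set G) :
  FC_group G -> is_subgroup H -> almost_normal H.
Proof.
move=> fc sgH g; exists [set g ^ h | h in H].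
  by apply: sub_finite_set (fc g) => _ [h _ <-]; exists h.
apply/seteqP; split=> [_ [[h k] [/= Hh Hk] <-]|_ [_ [h Hh <-] [k Hk <-]]].
  exists (g ^ h^-1); first by exists h^-1 => //; exact: subgroupV.
  by exists (h * k); [exact: subgroupM | rewrite mulgA -conjgCV].
exists (h^-1, h * k); last by rewrite /= conjgE !mulgA.
by split; [exact: subgroupV | exact: subgroupM].
Qed.

(** The family is indexed by ['I_k] so that words can be sorted by index. *)
Definition conj_invariant k (T : 'I_k -> G) : Prop :=
  forall i g, exists j, T i ^ g = T j.

(** [T] enumerates the conjugacy classes of the given generators and of their inverses, a finite
    union of finite sets. *)
Lemma FC_group_conj_generators :
  finitely_generated G -> FC_group G ->
  exists k (T : 'I_k -> G), [/\ conj_invariant T,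
    forall i, exists j, (T i)^-1 = T j &
    forall g, exists s, g = \prod_(i <- s) T i].
Proof.
case=> S [finS genS] fc.
pose U := \bigcup_(x in S) ([set x ^ g | g in [set: G]] `|`
                           [set x^-1 ^ g | g in [set: G]]).
have finU : finite_set U.
  by apply: bigcup_finite => // x _; rewrite finite_setU.
have [r Ur] : exists r : seq G, U = [set` r] by apply/finite_seqP.
have T_U (i : 'I_(size r)) : U (tnth (in_tuple r) i).
  by rewrite Ur /=; exact: mem_tnth.
have U_T x : U x -> exists i, x = tnth (in_tuple r) i.
  by rewrite Ur /= => xr; apply/tnthP.
exists (size r), (tnth (in_tuple r)).
have TJ : conj_invariant (tnth (in_tuple r)).
  move=> i g; apply: U_T; have [x Sx [] [h _ <-]] := T_U i; exists x => //.
    by left; exists (h * g); rewrite ?conjgM.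
  by right; exists (h * g); rewrite ?conjgM.
have TV i : exists j, (tnth (in_tuple r) i)^-1 = tnth (in_tuple r) j.
  apply: U_T; have [x Sx [] [h _ <-]] := T_U i; exists x => //.
    by right; exists h; rewrite ?conjVg.
  by left; exists h; rewrite ?conjVg ?invgK.
split=> // g.
pose K : set G := [set g | exists s, g = \prod_(i <- s) tnth (in_tuple r) i].
suff : K g by [].
have : generated S g by rewrite genS.
apply.
  apply: is_subgroupP; first by exists [::]; rewrite big_nil.
    move=> _ [s ->]; elim: s => [|i s [t IHs]].
      by exists [::]; rewrite big_nil invg1.
    have [j Tj] := TV i; exists (t ++ [:: j]).
    by rewrite big_cons invgM big_cat big_seq1 /= -IHs Tj.
  by move=> _ _ [s ->] [t ->]; exists (s ++ t); rewrite big_cat.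
move=> x Sx; have [i ->] : exists i, x = tnth (in_tuple r) i.
  by apply: U_T; exists x => //; left; exists 1; rewrite ?conjg1.
by exists [:: i]; rewrite big_seq1.
Qed.

End FC.

(** * Words in a conjugation-invariant family and the length they define *)

Section Words.
Variables (G : groupType) (k : nat) (T : 'I_k -> G).
Hypothesis TJ : conj_invariant T.
Local Notation word s := (\prod_(i <- s) T i)%g.

(** This moves elements of [H] across a word without changing its length. *)
Lemma word_conj s g : exists2 t, size t = size s & (word s ^ g)%g = word t.
Proof.
elim: s => [|i s [t size_t IHs]].
  by exists [::] => //; rewrite !big_nil conj1g.
have [j Tj] := TJ i g; exists (j :: t); first by rewrite /= size_t.
by rewrite !big_cons conjMg IHs Tj.
Qed.

(** The first letter is the most significant digit, so on words of equal length this is the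
    lexicographic order. *)
Fixpoint digits (s : seq 'I_k) : nat :=
  if s is i :: s' then (i * k ^ size s' + digits s')%N else 0%N.

Let leI (i j : 'I_k) := (i <= j)%N.

(* Among the words of a given length for [g], one with the least base-[k] value
   is sorted: [T x * T y = T y * T x'] with [y < x] would decrease it. *)
Lemma word_sort s : exists t : seq 'I_k,
  [/\ size t = size s, word t = word s & sorted leI t].
Proof.
have [n] := ubnP (digits s); elim: n s => // n IHn s lt_s_n.
have [|] := boolP (sorted leI s); first by exists s.
suff desc u : ~~ sorted leI u -> exists v,
    [/\ size v = size u, word v = word u & (digits v < digits u)%N].
  move=> /desc [v [size_v wv lt_v_s]].
  have [t [size_t wt st]] := IHn v (leq_trans lt_v_s lt_s_n).
  by exists t; rewrite size_t wt.
elim: u => //= x [|y u] // IHu /=.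
rewrite negb_and; have [/= le_xy /IHu [v [sv wv lt_v]]|] := boolP (leI x y).
  exists (x :: v); rewrite /= sv; split=> //.
    by rewrite !big_cons wv big_cons.
  by rewrite ltn_add2l.
rewrite /leI -ltnNge => lt_yx _.
have [j Tj] := TJ x (T y); exists [:: y, j & u]; split=> //.
  by rewrite !big_cons !mulgA -Tj -conjgC.
(* The leading digits already decide: [y * k + j < (y + 1) * k <= x * k], because [j < k] and
   [y < x]. *)
rewrite /= !addnA ltn_add2r expnS.
have P_gt0 : (0 < k ^ size u)%N.
  by rewrite expn_gt0 (leq_ltn_trans _ (ltn_ord x)).
have lt_jk : (j * k ^ size u < k * k ^ size u)%N by rewrite ltn_pmul2r ?ltn_ord.
have le_yx : (y.+1 * (k * k ^ size u) <= x * (k * k ^ size u))%N.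
  by rewrite leq_mul2r lt_yx orbT.
rewrite mulSn in le_yx; lia.
Qed.

End Words.

(** [c g] counts the letters of a sorted word of minimal length representing the coset of [g]; the
    counts determine the sorted word, hence the coset. *)
Lemma length_of_conj_generators (G : groupType) (H : set G) k (T : 'I_k -> G) :
  is_subgroup H -> conj_invariant T ->
  (forall i, exists j, (T i)^-1%g = T j) ->
  (forall g, exists s, g = \prod_(i <- s) T i)%g ->
  exists (len : G -> nat) (c : G -> {ffun 'I_k -> nat}),
    [/\ (forall h, H h -> len h = 0%N), (forall g, len g^-1%g = len g),
        (forall g h, (len (g * h)%g <= len g + len h)%N),
        (forall g i, (c g i <= len g)%N) &
        (forall g g', c g = c g' -> rcoset H g = rcoset H g')].
Proof.
move=> sgH TJ TV Tgen.
pose B g n := exists s h, [/\ size s = n, H h & g = h * \prod_(i <- s) T i]%g.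
have exB g : exists n, `[< B g n >].
  have [s gs] := Tgen g; exists (size s); apply/asboolP; exists s, 1%g.
  by split; rewrite ?mul1g //; exact: subgroup1.
pose len g := ex_minn (exB g).
have lenP g : B g (len g) by rewrite /len; case: ex_minnP => n /asboolP.
have len_le g n : B g n -> (len g <= n)%N.
  by move=> /asboolP Bgn; rewrite /len; case: ex_minnP => m _; exact.
have leI_trans : transitive (fun i j : 'I_k => (i <= j)%N).
  by move=> ? ? ?; exact: leq_trans.
have leI_anti : antisymmetric (fun i j : 'I_k => (i <= j)%N).
  by move=> i j /anti_leq/val_inj.
have /choice [w wP] g : exists s, [/\ size s = len g,
    sorted (fun i j : 'I_k => (i <= j)%N) s &
    exists2 h, H h & g = h * \prod_(i <- s) T i]%g.
  have [s [h [size_s Hh gs]]] := lenP g.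
  have [t [size_t wt st]] := word_sort TJ s.
  by exists t; rewrite size_t size_s wt; split=> //; exists h.
have lenV_le g : (len g^-1%g <= len g)%N.
  have [s [h [size_s Hh gs]]] := lenP g; apply: len_le.
  have [t size_t wt] : exists2 t, size t = size s &
      ((\prod_(i <- s) T i)^-1 = \prod_(i <- t) T i)%g.
    elim: (s) => [|i s' [t size_t IHs]].
      by exists [::]; rewrite ?big_nil ?invg1.
    have [j Tj] := TV i; exists (rcons t j); first by rewrite size_rcons size_t.
    by rewrite big_cons invgM big_rcons IHs Tj.
  (* For a word [s] with inverse [t], the inverse of [h * s] is [t * h^-1 = h^-1 * t ^ h^-1]. *)
  have [u size_u wu] := word_conj TJ t h^-1%g.
  exists u, h^-1%g; rewrite size_u size_t size_s; split=> //.
    exact: subgroupV.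
  by rewrite gs invgM wt -wu -conjgC.
exists len, (fun g => [ffun i => count_mem i (w g)]); split=> //.
- move=> h Hh; apply/eqP; rewrite -leqn0; apply: len_le.
  by exists [::], h; rewrite big_nil mulg1.
- by move=> g; apply/eqP; rewrite eqn_leq lenV_le -{1}[g]invgK lenV_le.
- move=> g g'; apply: len_le.
  have [s [h [size_s Hh gs]]] := lenP g.
  have [s' [h' [size_s' Hh' gs']]] := lenP g'.
  (* For words [s] and [s']: [(h * s) * (h' * s') = (h * h') * (s ^ h' * s')]. *)
  have [t size_t wt] := word_conj TJ s h'.
  exists (t ++ s'), (h * h')%g; split.
      by rewrite size_cat size_t size_s size_s'.
    exact: subgroupM.
  by rewrite big_cat -wt gs gs' /= -!mulgA mulVKg.
- by move=> g i; rewrite ffunE; have [<- _ _] := wP g; exact: count_size.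
move=> g g' eq_c; have [_ st [h Hh gs]] := wP g.
have [_ st' [h' Hh' gs']] := wP g'.
have eq_w : w g = w g'.
  apply: sorted_eq leI_trans leI_anti _ _ st st' _.
  by apply/allP => i _ /=; move/ffunP: eq_c => /(_ i); rewrite !ffunE => ->.
by rewrite gs gs' !rcoset_eq // eq_w.
Qed.

(** * Elementary inequalities for finite sums *)

Section FiniteSums.
Variable R : realFieldType.

(** Telescoping: [(1 + j) ^- 2 <= j^-1 - (1 + j)^-1] for [j > 0], so the induction carries the
    remainder [(1 + n)^-1]. *)
Lemma sum_inv_sqr_le2 n : \sum_(j < n) (1 + j%:R : R) ^- 2 <= 2.
Proof.
case: n => [|n]; first by rewrite big_ord0.
suff: \sum_(j < n.+1) (1 + j%:R : R) ^- 2 <= 2 - (1 + n%:R)^-1.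
  by move=> /le_trans; apply; rewrite gerBl invr_ge0 addr_ge0.
elim: n => [|n IHn].
  rewrite big_ord1 /= !addr0 expr1n !invr1. lra.
rewrite big_ord_recr /=; apply: le_trans (lerD IHn (lexx _)) _.
have x_ge0 : 0 <= n%:R :> R by [].
rewrite -[n.+1%:R]natr1; move: (n%:R : R) x_ge0 => x x_ge0.
have x1 : 0 < 1 + x by lra.
have x2 : 0 < 1 + (x + 1) by lra.
suff : 0 <= (1 + x)^-1 - (1 + (x + 1))^-1 - (1 + (x + 1)) ^- 2 by lra.
have -> : (1 + x)^-1 - (1 + (x + 1))^-1 - (1 + (x + 1)) ^- 2 =
    ((1 + x) * (1 + (x + 1)) ^+ 2)^-1.
  by field; rewrite !gt_eqF.
by rewrite invr_ge0 mulr_ge0 ?exprn_ge0 ?ltW.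
Qed.

(** Each term is at most [\prod_i (1 + c x i) ^- 2]. By injectivity of [c] these products are
    distinct terms in the expansion of the [k]-th power of a sum bounded by 2. *)
Lemma polynomial_growth_sum_le k m (X : eqType) (r : seq X)
    (c : X -> {ffun 'I_k -> nat}) (len : X -> nat) :
  uniq r -> {in r &, injective c} -> (forall x i, (c x i <= len x)%N) ->
  (2 * k <= m)%N ->
  \sum_(x <- r) (1 + (len x)%:R : R) ^- m <= 2 ^+ k.
Proof.
move=> uniq_r inj_c le_c le_m.
pose M := \max_(x <- r) len x.
have c_lt x i : x \in r -> (c x i < M.+1)%N.
  by move=> xr; apply: leq_trans (le_c x i) _; exact: leq_bigmax_seq.
pose q (j : nat) : R := (1 + j%:R) ^- 2.
have q_ge0 j : 0 <= q j by rewrite invr_ge0 exprn_ge0 // addr_ge0.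
(* Bounding the counts by [M] gives a finite index type, over which the product of sums can be
   expanded. *)
pose d x := [ffun i => inord (c x i)] : {ffun 'I_k -> 'I_M.+1}.
have dE x i : x \in r -> d x i = c x i :> nat.
  by move=> xr; rewrite ffunE inordK ?c_lt.
have le_q x : x \in r -> (1 + (len x)%:R) ^- m <= \prod_i q (d x i).
  move=> xr; have lx : 1 <= 1 + (len x)%:R :> R by rewrite lerDl.
  apply: (@le_trans _ _ (\prod_(i < k) (1 + (len x)%:R) ^- 2)).
    rewrite prodr_const card_ord exprVn -exprM.
    rewrite lef_pV2 ?posrE ?exprn_gt0 ?(lt_le_trans ltr01) //.
    exact: ler_weXn2l.
  apply: ler_prod => i _; rewrite invr_ge0 exprn_ge0 ?(le_trans ler01) //=.
  rewrite dE // /q lef_pV2 ?posrE ?exprn_gt0 ?(lt_le_trans ltr01) ?lerDl //.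
  by rewrite lerXn2r ?nnegrE ?addr_ge0 // lerD2l ler_nat.
rewrite big_seq; apply: le_trans (ler_sum _ le_q) _; rewrite -big_seq.
rewrite -(big_map d xpredT (fun f => \prod_i q (f i))).
have uniq_d : uniq (map d r).
  rewrite map_inj_in_uniq // => x y xr yr /ffunP eq_d; apply: inj_c => //.
  by apply/ffunP => i; rewrite -!dE ?eq_d.
rewrite big_uniq //=.
apply: (@le_trans _ _ (\sum_(f : {ffun 'I_k -> 'I_M.+1}) \prod_i q (f i))).
  rewrite [leRHS](bigID (mem (map d r))) /= lerDl.
  by apply: sumr_ge0 => f _; apply: prodr_ge0.
rewrite -(bigA_distr_bigA (fun _ (j : 'I_M.+1) => q j)) /=.
rewrite prodr_const card_ord lerXn2r ?nnegrE ?sum_inv_sqr_le2 //.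
exact: sumr_ge0.
Qed.

(* Expand [0 <= \sum_i w i * (x i - t) ^+ 2] at [t = (\sum_i w i * x i) / W]. *)
Lemma weighted_cauchy_schwarz (I : Type) (r : seq I) (w x : I -> R) W :
  (forall i, 0 <= w i) -> 0 < W -> \sum_(i <- r) w i <= W ->
  (\sum_(i <- r) w i * x i) ^+ 2 <= W * \sum_(i <- r) w i * x i ^+ 2.
Proof.
move=> w_ge0 W_gt0 le_W.
set S := \sum_(i <- r) w i * x i; set Q := \sum_(i <- r) w i * x i ^+ 2.
pose t := S / W.
have : 0 <= \sum_(i <- r) w i * (x i - t) ^+ 2.
  by apply: sumr_ge0 => i _; rewrite mulr_ge0 // sqr_ge0.
have -> : \sum_(i <- r) w i * (x i - t) ^+ 2 =
    Q - 2 * t * S + t ^+ 2 * \sum_(i <- r) w i.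
  rewrite /Q /S !mulr_sumr -sumrB -big_split /=.
  by apply: eq_bigr => i _; ring.
(* The coefficient [t ^+ 2] is nonnegative, so the total weight may be raised to [W]. *)
move=> h; have {h} : 0 <= Q - 2 * t * S + t ^+ 2 * W.
  by apply: le_trans h _; rewrite lerD2l ler_wpM2l // sqr_ge0.
rewrite /t -(pmulr_rge0 _ W_gt0).
have -> : W * (Q - 2 * (S / W) * S + (S / W) ^+ 2 * W) = W * Q - S ^+ 2.
  by field; rewrite gt_eqF.
by rewrite subr_ge0.
Qed.

End FiniteSums.

(** * Complex moduli, and extended real norms tested on finite sums *)

Lemma normc_ge0 (R : rcfType) (z : R[i]) : 0 <= normc z.
Proof. by case: z => a b; rewrite sqrtr_ge0. Qed.

(** The witness is the support of [F] in [D]; if that is infinite, the list is empty and both sides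
    are 0. *)
Lemma normc_fsum_le (R : rcfType) (I : choiceType) (D : set I) (F : I -> R[i]) :
  exists r : seq I, [/\ uniq r, [set` r] `<=` D &
    normc (\sum_(i \in D) F i) <= \sum_(i <- r) normc (F i)].
Proof.
exists (finite_support 0 D F); split=> //.
  by case: finite_supportP.
elim/big_ind2: _ => // [|x a y b le_ax le_by]; first by rewrite normc0.
exact: le_trans (le_normcD a b) (lerD le_ax le_by).
Qed.

Lemma sqrte_leP (R : realType) (e : \bar R) (c : R) :
  (0 <= e)%E -> 0 <= c -> (e `^ 2^-1 <= c%:E)%E <-> (e <= (c ^+ 2)%:E)%E.
Proof.
case: e => [r| |] // e_ge0 c_ge0; last first.
  by rewrite poweRyr ?invr_neq0 // !leye_eq.
rewrite lee_fin in e_ge0.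
by rewrite poweR_EFin !lee_fin powR12_sqrt // -{1}(ger0_norm c_ge0) -sqrtr_sqr
  ler_sqrt ?sqr_ge0.
Qed.

Lemma esum_leP (R : realType) (T : choiceType) (D : set T) (a : T -> R)
    (M : R) :
  (\esum_(x in D) (a x)%:E <= M%:E)%E <->
  (forall r : seq T, uniq r -> [set` r] `<=` D -> \sum_(x <- r) a x <= M).
Proof.
split=> [le_M r uniq_r rD|le_M].
  rewrite -lee_fin; apply: le_trans le_M; apply: esum_ge.
  by exists [set` r]; rewrite -?fsbig_seq ?sumEFin.
apply: ge_ereal_sup => _ [X [finX XD] <-].
rewrite fsbig_finite // sumEFin lee_fin; apply: le_M.
  exact: finmap.fset_uniq.
by move=> x /=; rewrite in_fset_set // inE; exact: XD.
Qed.

Lemma sqrt_esum_leP (R : realType) (T : choiceType) (D : set T) (a : T -> R)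
    (c : R) : (forall x, 0 <= a x) -> 0 <= c ->
  ((\esum_(x in D) (a x)%:E) `^ 2^-1 <= c%:E)%E <->
  (forall r : seq T, uniq r -> [set` r] `<=` D -> \sum_(x <- r) a x <= c ^+ 2).
Proof.
move=> a_ge0 c_ge0; rewrite -esum_leP; apply: sqrte_leP => //.
by apply: esum_ge0 => x _; rewrite lee_fin.
Qed.

(** * Pointwise bounds and Schur's test on right cosets *)

Section OperatorNorm.
Variables (R : realType) (G : groupType) (H : set G).
Hypothesis sgH : is_subgroup H.
Implicit Types (f xi : G -> R[i]) (L w : G -> R) (r : seq (set G)).

Lemma l2norm_leP xi (c : R) : 0 <= c ->
  (l2norm H xi <= c%:E)%E <->
  (forall r, uniq r -> [set` r] `<=` rcosets H ->
     \sum_(A <- r) normc (xi (coset_rep A)) ^+ 2 <= c ^+ 2).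
Proof.
by move=> c_ge0; apply: sqrt_esum_leP => // A; exact: sqr_ge0.
Qed.

(** The coset of [g] alone contributes [(normc (f g) * (1 + L g) ^+ m) ^+ 2] to the squared norm,
    since [f] and [L] are left [H]-invariant. *)
Lemma hecke_fun_pointwise_le f L m (N : R) g :
  left_invariant H f -> pair_length_function H L -> 0 <= N ->
  (weighted_norm H m%:R L f <= N%:E)%E ->
  normc (f g) <= N * (1 + L g) ^- m.
Proof.
move=> f_inv [L_length L_ker] N_ge0.
have L_ge0 := length_ge0 L_length.
have LH h x : H h -> L (h * x)%g = L x.
  move=> Hh; apply/eqP; rewrite eq_le; apply/andP; split.
    by apply: le_trans (lengthM L_length h x) _; rewrite (L_ker h Hh) add0r.
  rewrite -{1}(mulKg h x); apply: le_trans (lengthM L_length _ _) _.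
  by rewrite (lengthV L_length) (L_ker h Hh) add0r.
have L1_gt0 : 0 < 1 + L g by rewrite ltr_pwDl.
pose a A := normc (f (coset_rep A)) ^+ 2 * (1 + L (coset_rep A)) `^ (2 * m%:R).
have a_ge0 A : 0 <= a A by rewrite mulr_ge0 ?sqr_ge0 ?powR_ge0.
move=> /(sqrt_esum_leP (rcosets H) a_ge0 N_ge0) /(_ [:: rcoset H g] isT).
have sub : [set` [:: rcoset H g]] `<=` rcosets H.
  by move=> A /=; rewrite inE => /eqP ->; exists g.
move=> /(_ sub); rewrite big_seq1 /a.
have [h Hh ->] := coset_rep_rcoset sgH g; rewrite f_inv // LH //.
rewrite -(natrM _ 2) powR_mulrn ?(ltW L1_gt0) // mulnC exprM -exprMn.
rewrite ler_pXn2r ?nnegrE ?mulr_ge0 ?normc_ge0 ?exprn_ge0 ?(ltW L1_gt0) //.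
by rewrite ler_pdivlMr ?exprn_gt0.
Qed.

(** Weighted Cauchy-Schwarz in each row of the kernel [K], then exchange of the two sums. By [wV]
    the kernel is symmetric, so [w_sum] bounds both its row and its column sums. *)
Lemma opnorm_le_schur f w (N W : R) :
  0 <= N -> 0 < W -> (forall g, 0 <= w g) -> (forall g, w g^-1%g = w g) ->
  (forall g r, uniq r -> [set` r] `<=` rcosets H ->
     \sum_(A <- r) w (coset_rep A * g)%g <= W) ->
  (forall g, normc (f g) <= N * w g) ->
  (opnorm H f <= (W * N)%:E)%E.
Proof.
move=> N_ge0 W_gt0 w_ge0 wV w_sum f_le.
apply: ge_ereal_sup => _ [xi [_ xi_le1] <-].
have WN_ge0 : 0 <= W * N by rewrite mulr_ge0 ?(ltW W_gt0).
apply/l2norm_leP => // r uniq_r rH.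
pose x B := normc (xi (coset_rep B)).
pose K A B := w (coset_rep A * (coset_rep B)^-1)%g.
have K_ge0 A B : 0 <= K A B by exact: w_ge0.
have KC A B : K A B = K B A by rewrite /K -wV invgM invgK.
have /choice [E EP] A : exists q : seq (set G),
    [/\ uniq q, [set` q] `<=` rcosets H &
        normc (regular_rep H f xi (coset_rep A)) <=
          N * \sum_(B <- q) K A B * x B].
  have [q [uniq_q qH le_q]] := normc_fsum_le (rcosets H)
    (fun B => f (coset_rep A * (coset_rep B)^-1)%g * xi (coset_rep B)).
  exists q; split=> //; apply: le_trans le_q _.
  rewrite mulr_sumr; apply: ler_sum => B _.
  by rewrite normcM mulrA ler_wpM2r // normc_ge0.
(* One finite list containing all the [E A], so that the order of summation can be exchanged. *)
pose Q := undup (flatten (map E r)).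
have QH : [set` Q] `<=` rcosets H.
  move=> B /=; rewrite mem_undup => /flatten_mapP[A _ BE].
  by have [_ + _] := EP A; exact.
have uniq_Q : uniq Q by exact: undup_uniq.
apply: (@le_trans _ _
  (\sum_(A <- r) N ^+ 2 * (W * \sum_(B <- Q) K A B * x B ^+ 2))).
  rewrite big_seq [leRHS]big_seq; apply: ler_sum => A Ar.
  have [uniq_E EH le_E] := EP A.
  have sum_ge0 : 0 <= \sum_(B <- E A) K A B * x B.
    by apply: sumr_ge0 => B _; rewrite mulr_ge0 ?normc_ge0.
  apply: (@le_trans _ _ ((N * \sum_(B <- E A) K A B * x B) ^+ 2)).
    by rewrite ler_pXn2r ?nnegrE ?normc_ge0 ?mulr_ge0.
  rewrite exprMn ler_wpM2l ?sqr_ge0 //.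
  have le_W : \sum_(B <- E A) K A B <= W.
    by under eq_bigr do rewrite KC; exact: w_sum.
  apply: le_trans (weighted_cauchy_schwarz x (K_ge0 A) W_gt0 le_W) _.
  rewrite ler_wpM2l ?(ltW W_gt0) //.
  rewrite [leRHS](bigID (mem (E A))) /= -[X in X + _]big_filter.
  rewrite [X in X + _](perm_big (E A)) /= ?lerDl.
    by apply: sumr_ge0 => B _; rewrite mulr_ge0 ?sqr_ge0.
  apply: uniq_perm => [||B]; rewrite ?filter_uniq // mem_filter.
  rewrite andb_idr // => BE.
  by rewrite mem_undup; apply/flatten_mapP; exists A.
have -> : (W * N) ^+ 2 = N ^+ 2 * (W * W) by ring.
rewrite -!mulr_sumr !ler_wpM2l ?sqr_ge0 ?(ltW W_gt0) //.
rewrite exchange_big /=.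
apply: (@le_trans _ _ (\sum_(B <- Q) W * x B ^+ 2)).
  apply: ler_sum => B _; rewrite -mulr_suml ler_wpM2r ?sqr_ge0 //.
  exact: w_sum.
rewrite -mulr_sumr ger_pMr //.
by move/l2norm_leP : xi_le1 => /(_ ler01); rewrite expr1n; apply.
Qed.

End OperatorNorm.

(** * Property (RD) with respect to the word length modulo [H] *)

Theorem corollary2p9 (R : realType) (G : groupType) (H : set G)
    (fgG : finitely_generated G)
    (hG : FD_group G \/ FIZ_group G \/ FC_group G)
    (sgH : is_subgroup H) :
  hecke_pair_has_RD R G H.
Proof.
have fc : FC_group G.
  by case: hG => [/FD_group_FC|[/FIZ_group_FC|]].
split; first exact: FC_group_almost_normal.
have [k [T [TJ TV Tgen]]] := FC_group_conj_generators fgG fc.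
have [len [c [lenH lenV lenM c_le c_inj]]] :=
  length_of_conj_generators sgH TJ TV Tgen.
pose L g : R := (len g)%:R.
have pair_L : pair_length_function H L.
  split; last by move=> h Hh; rewrite /length_kernel /= /L lenH.
  split=> [g|| g|g h]; rewrite /L ?lenV ?ler0n //.
    by rewrite lenH //; exact: subgroup1.
  by rewrite -natrD ler_nat.
(* The sum bound asks for an exponent at least [2 * k]; the successor keeps it positive when
   [k = 0]. *)
exists L; split=> //; exists (2 ^+ k), (2 * k).+1%:R.
split; rewrite ?exprn_gt0 // => f [f_inv _ _].
have norm_ge0 : (0 <= weighted_norm H (2 * k).+1%:R L f)%E by exact: poweR_ge0.
(* If the weighted norm is [+oo], so is the right-hand side, because [2 ^+ k > 0]. *)
case norm_f: (weighted_norm _ _ _ _) norm_ge0 => [N| |] // N_ge0; last first.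
  by rewrite gt0_muley ?leey // lte_fin exprn_gt0.
rewrite lee_fin in N_ge0; rewrite -EFinM.
apply: (@opnorm_le_schur _ _ _ _ (fun g => (1 + L g) ^- (2 * k).+1)) => //.
- by move=> g; rewrite invr_ge0 exprn_ge0 // addr_ge0 // ler0n.
- by move=> g; rewrite /L lenV.
- move=> g r uniq_r rH.
  apply: (@polynomial_growth_sum_le _ k _ _ r (fun A => c (coset_rep A * g)%g)
    (fun A => len (coset_rep A * g)%g)) => //.
  (* Right translation by [g] is injective on right cosets, so distinct cosets have distinct
     counts. *)
  move=> A A' /rH HA /rH HA' /c_inj eq_coset.
  rewrite -(rcoset_coset_rep sgH HA) -(rcoset_coset_rep sgH HA').
  have : rcoset H (coset_rep A' * g)%g (coset_rep A * g)%g.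
    by rewrite -eq_coset; exact: rcoset_id.
  by case=> h Hh; rewrite mulgA => /mulIg <-; rewrite rcoset_eq.
move=> g; apply: (hecke_fun_pointwise_le sgH g f_inv pair_L N_ge0).
by rewrite norm_f.
Qed.
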